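(* Let $k\geq 3$ be an odd integer and let $n\geq 5$ be an integer. Then $smp^{k}(A_{n,2})=2n-4$.
   Context: The arrangement graph $A_{n,2}$ has as vertices all ordered pairs $[a_1,a_2]$ of distinct elements of $\{1,\dots,n\}$, two vertices being adjacent iff they differ in exactly one position; it is $2(n-2)$-regular. An integer $k$-matching of $G$ is a function $h:E(G)\to\{0,1,\dots,k\}$ with $\sum_{e\in\Gamma(v)}h(e)\leq k$ for all $v$ ($\Gamma(v)$ the edges incident with $v$); it is perfect if every vertex has sum $k$, and almost perfect if exactly one vertex has sum $k-1$ and all others have sum $k$. For $F\subseteq V(G)\cup E(G)$, $G-F$ is obtained by deleting the vertices of $F$ (with incident edges) and the edges of $F$. $smp^{k}(G)$ is the minimum size of $F\subseteq V(G)\cup E(G)$ such that $G-F$ has neither a perfect nor an almost perfect integer $k$-matching. *)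

(* Defs.v *)
From mathcomp Require Import all_boot.
Set Implicit Arguments. Unset Strict Implicit. Unset Printing Implicit Defensive.

Section Graph.
Variables (V : finType) (adj : rel V).

(* Edges of the simple graph given by the symmetric irreflexive relation adj:
   2-element sets {u,v} with u adjacent to v. *)
Definition is_edge (e : {set V}) : bool :=
  [exists u, exists v, adj u v && (e == [set u; v])].
Definition edge := {e : {set V} | is_edge e}.

Definition delset := ({set V} * {set edge})%type.
Definition dsize (F : delset) : nat := #|F.1| + #|F.2|.

Definition alive (F : delset) (e : edge) : bool :=
  (e \notin F.2) && [forall v in val e, v \notin F.1].

Definition hdeg k (h : {ffun edge -> 'I_k.+1}) (v : V) : nat :=
  \sum_(e : edge | v \in val e) (h e : nat).

(* h is an integer k-matching of G - F (extended by 0 on deleted edges). *)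
Definition int_matching_of k (F : delset) (h : {ffun edge -> 'I_k.+1}) : bool :=
  [forall e, ~~ alive F e ==> (h e == 0 :> nat)] &&
  [forall v, (v \notin F.1) ==> (hdeg h v <= k)].

Definition perfect_int_matching k (F : delset) (h : {ffun edge -> 'I_k.+1}) :=
  int_matching_of F h && [forall v, (v \notin F.1) ==> (hdeg h v == k)].

Definition almost_perfect_int_matching k (F : delset)
    (h : {ffun edge -> 'I_k.+1}) :=
  int_matching_of F h &&
  [exists v0, [&& v0 \notin F.1, hdeg h v0 == k.-1 &
     [forall v, ((v \notin F.1) && (v != v0)) ==> (hdeg h v == k)]]].

Definition has_pm_or_apm k (F : delset) : bool :=
  [exists h : {ffun edge -> 'I_k.+1},
     perfect_int_matching F h || almost_perfect_int_matching F h].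

Definition smp (k : nat) : nat :=
  \big[minn/(#|V| + #|{: edge}|).+1]_(F : delset | ~~ has_pm_or_apm k F) dsize F.

End Graph.

Definition arrV (n : nat) := {p : 'I_n * 'I_n | p.1 != p.2}.
Definition arr_adj (n : nat) : rel (arrV n) := fun u v =>
  (((val u).1 == (val v).1) && ((val u).2 != (val v).2)) ||
  (((val u).1 != (val v).1) && ((val u).2 == (val v).2)).

(* Main.v *)
(**
Replacing every vertex by k independent copies turns perfect and almost perfect
integer k-matchings of G - F into matchings missing at most one vertex. By the
Tutte-Berge formula, if G - F has neither, then there are a set S of vertices and
a partition of the rest of G - F into unions of components, of which i are
isolated vertices and q are not, with k |S| + 2 <= k i + q.

The graph A_{n,2} is the n x n rook's graph without its diagonal. Suppose that
deleting a set X of cells and a set M of edges separates it into c parts. Then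
|X| + |M| >= 2n - 4 if c = 2 and |X| + |M| >= 2n - 5 + c if c >= 3; applied to
X = S together with the deleted vertices, this contradicts |F| <= 2n - 5.
For the estimate, induct on |M|: an endpoint of an edge of M whose part is not a
singleton can be moved to X at no cost, two singleton parts joined by an edge of
M can be merged when c >= 4, and otherwise X and M contain the neighbourhoods of
these singletons. When M is empty, every row and every column meets at most one
part, and X contains all cells whose row and column belong to different parts.
*)
Require Import Defs.
From mathcomp Require Import all_boot zify.
Set Implicit Arguments. Unset Strict Implicit. Unset Printing Implicit Defensive.

(** * The Tutte-Berge formula *)

Section TutteBerge.
Variables (T : finType) (e : rel T).
Hypotheses (e_sym : symmetric e) (e_irr : irreflexive e).
Implicit Types (U S : {set T}) (M N : {set {set T}}).

Definition matching U M :=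
  trivIset M && [forall E in M, [exists x in U, [exists y in U,
    e x y && (E == [set x; y])]]].

Definition max_matching U M :=
  matching U M && [forall N, matching U N ==> (#|N| <= #|M|)].

Lemma matchingP U M E : matching U M -> E \in M ->
  exists x y, [/\ x \in U, y \in U, e x y & E = [set x; y]].
Proof.
case/andP=> _ /forall_inP Mp /Mp /exists_inP[x xU /exists_inP[y yU /andP[exy /eqP ->]]].
by exists x, y.
Qed.

Lemma matching_edge U M E x : matching U M -> E \in M -> x \in E ->
  exists y, [/\ x \in U, y \in U, e x y & E = [set x; y]].
Proof.
move=> mM EM; have [a [b [aU bU eab ->]]] := matchingP mM EM.
case/set2P=> ->; first by exists b.
by exists a; rewrite e_sym setUC.
Qed.

Lemma matching_sub U M N : matching U M -> N \subset M -> matching U N.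
Proof.
move=> /andP[tM /forall_inP Mp] /subsetP sNM; apply/andP; split.
  by apply: trivIsetS tM; apply/subsetP.
by apply/forall_inP=> E /sNM /Mp.
Qed.

Lemma matchingW U1 U2 M : U1 \subset U2 -> matching U1 M -> matching U2 M.
Proof.
move=> /subsetP sU mM; have /andP[tM _] := mM; apply/andP; split=> //.
apply/forall_inP=> E /(matchingP mM)[x [y [xU yU exy ->]]].
by apply/exists_inP; exists x; [exact: sU|apply/exists_inP; exists y; [exact: sU|rewrite exy eqxx]].
Qed.

Lemma matching_cover U M : matching U M -> cover M \subset U.
Proof.
move=> mM; apply/subsetP=> x /bigcupP[E EM xE].
by have [y []] := matching_edge mM EM xE.
Qed.

Lemma card_matching_cover U M : matching U M -> #|cover M| = #|M|.*2.
Proof.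
move=> mM; have /andP[tM _] := mM.
rewrite -(eqP tM) -muln2 -sum_nat_const; apply: eq_bigr => E EM.
have [x [y [_ _ exy ->]]] := matchingP mM EM.
by rewrite cards2; case: eqP exy => // ->; rewrite e_irr.
Qed.

Lemma matching_add U M x y : matching U M -> x \in U -> y \in U -> e x y ->
  x \notin cover M -> y \notin cover M ->
  matching U ([set x; y] |: M) /\ #|[set x; y] |: M| = #|M|.+1.
Proof.
move=> mM xU yU exy xM yM.
have E_M : [set x; y] \notin M.
  by apply: contra xM => EM; apply/bigcupP; exists [set x; y]; rewrite ?set21.
split; last by rewrite cardsU1 E_M.
have /andP[tM /forall_inP Mp] := mM; apply/andP; split.
  apply/trivIsetP => A B /setU1P[->|AM] /setU1P[->|BM]; rewrite ?eqxx //.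
  - move=> _; rewrite disjoint_subset; apply/subsetP=> z zE; rewrite inE.
    by apply/negP => zB; case/set2P: zE zB => -> zB; [case/negP: xM|case/negP: yM];
      apply/bigcupP; exists B.
  - move=> _; rewrite disjoint_sym disjoint_subset; apply/subsetP=> z zE; rewrite inE.
    by apply/negP => zB; case/set2P: zE zB => -> zB; [case/negP: xM|case/negP: yM];
      apply/bigcupP; exists A.
  - by move=> AB; exact: (trivIsetP tM).
apply/forall_inP=> E /setU1P[->|/Mp//].
by apply/exists_inP; exists x => //; apply/exists_inP; exists y; rewrite ?exy ?eqxx.
Qed.

Lemma notin_cover_rem M E x :
  trivIset M -> E \in M -> x \in E -> x \notin cover (M :\ E).
Proof.
move=> tM EM xE; apply/negP => /bigcupP[A]; rewrite !inE => /andP[AE AM] xA.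
have := trivIsetP tM _ _ AM EM AE; rewrite disjoint_subset => /subsetP/(_ _ xA).
by rewrite inE xE.
Qed.

Lemma max_matching_card U M N :
  max_matching U M -> matching U N -> #|N| <= #|M|.
Proof. by case/andP=> _ /forall_inP; apply. Qed.

Lemma max_matching_exists U : exists M, max_matching U M.
Proof.
have m0 : matching U set0.
  apply/andP; split; first by apply/trivIsetP => A B; rewrite inE.
  by apply/forall_inP=> E; rewrite inE.
case: (@arg_maxnP _ set0 (matching U) (fun M => #|M|) m0) => M mM Mmax.
by exists M; rewrite /max_matching mM; apply/forall_inP.
Qed.

(* Gallai's lemma. Among the maximum matchings missing t take the one, N, sharing
   most edges with M: as N covers u and v, it misses some x <> t covered by M, and
   exchanging the N-edge at the M-partner of x for the M-edge at x improves N. *)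
Lemma missed_together_trans U M u t v :
  max_matching U M -> u != v -> u \notin cover M -> v \notin cover M ->
  (forall N, max_matching U N -> t \notin cover N ->
     (u \in cover N) && (v \in cover N)) ->
  forall N0, max_matching U N0 -> t \in cover N0.
Proof.
move=> xM uv uM vM cov N0 xN0; apply/negPn/negP => tN0.
have [N [xN tN Nmax]] : exists N, [/\ max_matching U N, t \notin cover N &
  forall N', max_matching U N' -> t \notin cover N' -> #|M :&: N'| <= #|M :&: N|].
  have P0 : [pred N | max_matching U N & t \notin cover N] N0 by rewrite /= xN0.
  case: (arg_maxnP (fun N => #|M :&: N|) P0) => N /andP[xN tN] Nmax.
  by exists N; split=> // N' xN' tN'; apply: Nmax; rewrite /= xN'.
have /andP[mM _] := xM; have /andP[mN _] := xN.
have /andP[tM _] := mM; have /andP[tNN _] := mN.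
have eqc : #|cover M| = #|cover N|.
  rewrite (card_matching_cover mM) (card_matching_cover mN); congr _.*2.
  by apply/eqP; rewrite eqn_leq !(@max_matching_card U).
have /andP[uN vN] := cov N xN tN.
have c2 : 1 < #|cover N :\: cover M|.
  have : [set u; v] \subset cover N :\: cover M.
    by apply/subsetP=> z /set2P[] ->; rewrite inE ?uM ?vM.
  by move/subset_leq_card; rewrite cards2 uv.
have c2' : 1 < #|cover M :\: cover N|.
  by move: c2; rewrite !cardsD setIC eqc.
have [x] : exists x, x \in (cover M :\: cover N) :\ t.
  apply/card_gt0P; move: c2'; rewrite (cardsD1 t); move: #|_ :\ t| => m.
  by case: (t \in _); case: m.
rewrite !inE => /and3P[xt xN' /bigcupP[E EM xE]].
have [y [xU yU exy defE]] := matching_edge mM EM xE.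
case: (boolP (y \in cover N)) => [/bigcupP[f fN yf]|yN]; last first.
  have [mN' cN'] := matching_add mN xU yU exy xN' yN.
  by have := max_matching_card xN mN'; rewrite cN' ltnn.
have f_M : f \notin M.
  apply/negP=> fM; case/negP: xN'; apply/bigcupP; exists f => //.
  case: (eqVneq f E) => [->//|fE].
  have := trivIsetP tM _ _ fM EM fE; rewrite disjoint_subset => /subsetP/(_ _ yf).
  by rewrite inE defE set22.
have mNf : matching U (N :\ f) by apply: matching_sub mN _; apply: subsetDl.
have xNf : x \notin cover (N :\ f).
  apply: contra xN' => /bigcupP[A]; rewrite inE => /andP[_ AN] xA.
  by apply/bigcupP; exists A.
have yNf := notin_cover_rem tNN fN yf.
have [mN' cN'] := matching_add mNf xU yU exy xNf yNf.
rewrite -defE in mN' cN'.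
have cN'N : #|E |: N :\ f| = #|N| by rewrite cN' [RHS](cardsD1 f) fN.
have tN' : t \notin cover (E |: N :\ f).
  apply/negP => /bigcupP[A /setU1P[->|]].
    rewrite defE => /set2P[tx|ty]; first by rewrite tx eqxx in xt.
    by case/negP: tN; apply/bigcupP; exists f; rewrite ?ty.
  by rewrite inE => /andP[_ AN] tA; case/negP: tN; apply/bigcupP; exists A.
have xN'' : max_matching U (E |: N :\ f).
  by rewrite /max_matching mN' cN'N; case/andP: xN.
(* As [f] is not in [M], the exchange keeps [M :&: N] and adds [E] to it. *)
have := Nmax _ xN'' tN'.
have -> : M :&: (E |: N :\ f) = E |: (M :&: N).
  apply/setP=> A; rewrite !inE; case: (eqVneq A E) => [->|_] /=; first by rewrite EM.
  by case: (eqVneq A f) => [->|_]; rewrite ?(negPf f_M).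
rewrite cardsU1; suff -> : E \notin M :&: N by rewrite add1n ltnn.
apply: contra xN'; rewrite inE => /andP[_ EN]; by apply/bigcupP; exists E.
Qed.

(** Induction on [#|U|]. A vertex covered by every maximum matching is deleted and put into [S]. If
    there is none, never being missed together is an equivalence relation by Gallai's lemma, and its
    classes serve as colours with [S] empty. *)
Lemma tutte_berge U : exists M S (col : T -> {set T}),
  [/\ matching U M, S \subset U,
      {in U :\: S &, forall x y, e x y -> col x = col y} &
      #|U :\: cover M| + #|S| <= #|col @: (U :\: S)|].
Proof.
have [m] := ubnP #|U|; elim: m U => // m IH U /ltnSE cU.
have [M xM] := max_matching_exists U; have /andP[mM _] := xM.
pose missed v := [exists N, max_matching U N && (v \notin cover N)].
case: (boolP [forall v in U, missed v]) => [/forall_inP all_missed|]; last first.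
  move=> /forall_inPn[v vU /existsPn v_cov].
  have sU : U :\ v \subset U by apply: subsetDl.
  have ltU : #|U :\ v| < m by apply: leq_trans cU; rewrite [leqRHS](cardsD1 v) vU.
  have [N [S [col [mN sS ok le]]]] := IH _ ltU.
  have mN' := matchingW sU mN.
  have vN : v \notin cover N.
    by apply/negP=> /(subsetP (matching_cover mN)); rewrite !inE eqxx.
  have lt : #|N| < #|M|.
    rewrite ltn_neqAle (max_matching_card xM mN') andbT; apply/eqP=> cNM.
    have /negP := v_cov N; apply; rewrite vN andbT /max_matching mN' cNM.
    by case/andP: xM.
  have vS : v \notin S by apply/negP => /(subsetP sS); rewrite !inE eqxx.
  have eqD : U :\: (v |: S) = U :\ v :\: S by rewrite setDDl.
  exists M, (v |: S), col; rewrite eqD; split=> //.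
    by rewrite subUset sub1set vU (subset_trans sS sU).
  (* Since [N] is smaller than [M], [M] misses fewer vertices of [U] than [N] misses in [U :\ v];
     this pays for the new element of [S]. *)
  apply: leq_trans le; rewrite cardsU1 vS !cardsD.
  rewrite (setIidPr (matching_cover mM)) (setIidPr (matching_cover mN)).
  rewrite (card_matching_cover mM) (card_matching_cover mN).
  rewrite (setIidPr _) ?sub1set // cards1.
  have := subset_leq_card (matching_cover mM).
  rewrite (card_matching_cover mM); lia.
pose sim x y := (x == y) ||
  [forall N, max_matching U N ==> ((x \in cover N) || (y \in cover N))].
have simP x y N : sim x y -> x != y -> max_matching U N ->
  (x \in cover N) || (y \in cover N).
  by case/orP=> [/eqP->|/forall_inP h]; [rewrite eqxx|move=> _; exact: h].
have sim_sym x y : sim x y = sim y x.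
  by rewrite /sim eq_sym; congr (_ || _); apply: eq_forallb => N; rewrite orbC.
have sim_trans u t v : t \in U -> sim u t -> sim t v -> sim u v.
  move=> tU; case: (eqVneq u t) => [->//|ut]; case: (eqVneq t v) => [->//|tv].
  move=> sut stv; case: (eqVneq u v) => [->|uv]; rewrite /sim ?eqxx //.
  apply/orP; right; apply/forall_inP=> N xN; apply/negPn; rewrite negb_or.
  apply/negP => /andP[uN vN].
  (* If [N] misses [u] and [v], while every maximum matching missing [t] covers both, then Gallai's
     lemma says that [t] is never missed. *)
  have [N0 /andP[xN0 /negP]] := existsP (all_missed t tU); apply.
  apply: (missed_together_trans xN uv uN vN) xN0 => N' xN' tN'.
  have := simP _ _ _ sut ut xN'; have := simP _ _ _ stv tv xN'.
  by rewrite (negPf tN') /= orbF => -> ->.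
exists M, set0, (fun x => [set y in U | sim x y]); rewrite setD0 cards0 addn0.
split=> //; first exact: sub0set.
  move=> x y xU yU exy.
  have sxy : sim x y.
    apply/orP; right; apply/forall_inP => N xN; apply/negPn; rewrite negb_or.
    apply/negP => /andP[xN' yN']; have /andP[mN _] := xN.
    have [mN' cN'] := matching_add mN xU yU exy xN' yN'.
    by have := max_matching_card xN mN'; rewrite cN' ltnn.
  apply/setP=> z; rewrite !inE; case: (z \in U) => //=; apply/idP/idP.
    by apply: sim_trans; rewrite // sim_sym.
  exact: sim_trans.
(* Distinct vertices missed by [M] get distinct colours, because [M] misses them together. *)
rewrite -(card_in_imset (f := fun x => [set y in U | sim x y]) (D := U :\: cover M)).
  by apply/subset_leq_card/imsetS/subsetDl.
move=> x y; rewrite !inE => /andP[xM' xU] /andP[yM' yU] /setP/(_ y).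
rewrite !inE yU {2}/sim eqxx /= => sxy; case: (eqVneq x y) => // xy.
by have := simP _ _ _ sxy xy xM; rewrite (negPf xM') (negPf yM').
Qed.

End TutteBerge.

(** * Barriers for integer k-matchings *)

Section BlowUp.
Variables (V : finType) (adj : rel V) (k : nat) (F : delset adj).
Hypotheses (adj_sym : symmetric adj) (adj_irr : irreflexive adj).

(** Only the edge deletions are recorded here; the deleted vertices are left out in
    [blowup_vertices]. *)
Definition live (u v : V) :=
  adj u v && ([set u; v] \notin [set val E | E in F.2]).

Definition blowup (p q : V * 'I_k) := live p.1 q.1.
Definition blowup_vertices : {set V * 'I_k} := [set p | p.1 \notin F.1].

Lemma live_sym : symmetric live.
Proof. by move=> u v; rewrite /live adj_sym setUC. Qed.

Lemma blowup_sym : symmetric blowup.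
Proof. by move=> p q; apply: live_sym. Qed.

Lemma blowup_irr : irreflexive blowup.
Proof. by move=> p; rewrite /blowup /live adj_irr. Qed.

Section FromMatching.
Variable M : {set {set V * 'I_k}}.
Hypothesis M_matching : matching blowup blowup_vertices M.

Definition base (m : {set V * 'I_k}) : {set V} := [set p.1 | p in m].

Lemma base_alive_edge m : m \in M -> exists2 E : edge adj, val E = base m & alive F E.
Proof.
move=> mM; have [p [q [pU qU /andP[apq nF] defm]]] := matchingP M_matching mM.
have baseE : base m = [set p.1; q.1] by rewrite /base defm imsetU !imset_set1.
have edge_m : is_edge adj (base m).
  by apply/existsP; exists p.1; apply/existsP; exists q.1; rewrite apq baseE eqxx.
exists (exist _ (base m) edge_m) => //; apply/andP; split.
  apply: contra nF => EF; rewrite -baseE.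
  by apply/imsetP; exists (exist _ (base m) edge_m).
apply/forall_inP => v /=; rewrite baseE => /set2P[]->.
  by move: pU; rewrite inE.
by move: qU; rewrite inE.
Qed.

Definition multiplicity (E : edge adj) := #|[set m in M | base m == val E]|.

Definition covered_copies (v : V) : {set 'I_k} := [set x | (v, x) \in cover M].

(** Copies of one vertex are not adjacent, so an edge of [M] over an edge at [v] contains exactly
    one copy of [v]; both sides count these edges of [M]. *)
Lemma sum_multiplicity v :
  \sum_(E : edge adj | v \in val E) multiplicity E = #|covered_copies v|.
Proof.
have /andP[tM _] := M_matching.
transitivity #|[set m in M | v \in base m]|.
  transitivity (\sum_(E : edge adj | v \in val E)
                  \sum_(m in M | base m == val E) 1).
    by apply: eq_bigr => E _; rewrite sum1_card; apply: eq_card => m; rewrite inE.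
  rewrite (exchange_big_dep (fun m => (m \in M) && (v \in base m))) /=; last first.
    by move=> E m vE /andP[-> /eqP ->].
  rewrite -sum1_card [RHS](eq_bigl (fun m => (m \in M) && (v \in base m))); last first.
    by move=> m; rewrite inE.
  apply: eq_bigr => m /andP[mM vm]; have [E EM _] := base_alive_edge mM.
  rewrite (big_pred1 E) // => E'; rewrite mM /= -EM (inj_eq val_inj) eq_sym.
  by case: eqP => [->|]; rewrite ?andbF // EM vm.
have -> : [set m in M | v \in base m] = [set pblock M (v, x) | x in covered_copies v].
  apply/setP=> m; rewrite inE; apply/andP/imsetP => [[mM /imsetP[[w x] wm /= ->]]|[x]].
    exists x; first by rewrite inE; apply/bigcupP; exists m.
    by rewrite (def_pblock tM mM wm).
  rewrite inE => cx ->; split; first exact: pblock_mem.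
  by apply/imsetP; exists (v, x) => //; rewrite mem_pblock.
apply: card_in_imset => x y; rewrite !inE => cx cy eqb.
have mM := pblock_mem cx; have xm : (v, x) \in pblock M (v, x) by rewrite mem_pblock.
have ym : (v, y) \in pblock M (v, x) by rewrite eqb mem_pblock.
have [q [_ _ aq eqm]] := matching_edge blowup_sym M_matching mM xm.
move: ym; rewrite eqm => /set2P[[]//|qy].
by move: aq; rewrite -qy /blowup /live /= adj_irr.
Qed.

Lemma card_covered_copies v :
  #|covered_copies v| + #|[set x | (v, x) \notin cover M]| = k.
Proof.
rewrite -[RHS]card_ord -[RHS](cardsC (covered_copies v)); congr (_ + _).
by apply: eq_card => x; rewrite !inE.
Qed.

Lemma multiplicity_le E : multiplicity E <= k.
Proof.
have [u uE] : exists u, u \in val E.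
  have /existsP[u /existsP[v /andP[_ /eqP ->]]] := valP E.
  by exists u; rewrite set21.
apply: (@leq_trans #|covered_copies u|); last first.
  by rewrite -[leqRHS](card_covered_copies u) leq_addr.
by rewrite -sum_multiplicity (bigD1 E) //= leq_addr.
Qed.

(** With multiplicities as weights, the degree of [v] is [k] minus the number of its missed
    copies. *)
Lemma has_pm_or_apm_of_matching : 0 < k ->
  #|blowup_vertices :\: cover M| <= 1 -> has_pm_or_apm k F.
Proof.
move=> k_gt0 missed.
pose h : {ffun edge adj -> 'I_k.+1} := [ffun E => inord (multiplicity E)].
have hE E : h E = multiplicity E :> nat by rewrite ffunE inordK // ltnS multiplicity_le.
have hdegE v : hdeg h v = #|covered_copies v|.
  by rewrite -sum_multiplicity; apply: eq_bigr => E _.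
have h_ok : int_matching_of F h.
  apply/andP; split.
    apply/forallP=> E; apply/implyP=> dead; rewrite hE cards_eq0 -subset0.
    apply/subsetP=> m; rewrite !inE => /andP[mM /eqP eqb]; case/negP: dead.
    by have [E' E'm] := base_alive_edge mM; have -> : E' = E by apply: val_inj; rewrite E'm.
  apply/forallP=> v; apply/implyP=> _; rewrite hdegE.
  by rewrite -[leqRHS](card_covered_copies v) leq_addr.
have full v : v \notin F.1 ->
    (forall x, (v, x) \notin blowup_vertices :\: cover M) -> hdeg h v = k.
  move=> vF nov; rewrite hdegE -[RHS](card_covered_copies v) [X in _ + X]eq_card0 ?addn0 //.
  by move=> x; rewrite !inE; have := nov x; rewrite !inE /= vF andbT => /negbTE.
apply/existsP; exists h; apply/orP.
case: (posnP #|blowup_vertices :\: cover M|) => [/eqP|pos].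
  rewrite cards_eq0 => /eqP none; left; apply/andP; split=> //.
  apply/forallP=> v; apply/implyP=> vF; apply/eqP/full => // x.
  by rewrite none inE.
have /cards1P[[v0 x0] missedE] : #|blowup_vertices :\: cover M| == 1 by rewrite eqn_leq missed.
have : (v0, x0) \in blowup_vertices :\: cover M by rewrite missedE set11.
rewrite !inE /= => /andP[x0M v0F].
right; apply/andP; split=> //; apply/existsP; exists v0; apply/and3P; split=> //.
  rewrite hdegE -[X in _ == X.-1](card_covered_copies v0).
  suff -> : [set x | (v0, x) \notin cover M] = [set x0] by rewrite cards1 addn1.
  apply/setP=> x; rewrite !inE; have /setP/(_ (v0, x)) := missedE.
  by rewrite !inE /= v0F andbT xpair_eqE eqxx.
apply/forallP=> v; apply/implyP=> /andP[vF vv0]; apply/eqP/full => // x.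
by rewrite missedE inE xpair_eqE (negPf vv0).
Qed.

End FromMatching.

(** A Tutte-Berge barrier [B] of the blow-up is pushed down to [S], the vertices with all copies in
    [B]. Outside [B], only copies of an isolated vertex can differ in colour, which gives at most
    [k] colours for each vertex of [I]. The 2 is the least number of missed copies. *)
Lemma barrier : 0 < k -> ~~ has_pm_or_apm k F ->
  exists (S I : {set V}) (C : finType) (col : V -> C),
    let Y := ~: (F.1 :|: S) in
    [/\ [disjoint F.1 & S], I \subset Y,
        {in Y &, forall x y, live x y -> col x = col y},
        {in I & Y, forall x y, col x = col y -> x = y} &
        k * #|S| + 2 <= k * #|I| + #|col @: (Y :\: I)|].
Proof.
move=> k_gt0 none.
have [M [B [col [mM sB ok le]]]] := tutte_berge blowup_sym blowup_irr blowup_vertices.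
have missed : 1 < #|blowup_vertices :\: cover M|.
  by rewrite ltnNge; apply: contra none; apply: has_pm_or_apm_of_matching mM k_gt0.
pose S := [set v | (v \notin F.1) && [forall x, (v, x) \in B]].
pose Y := ~: (F.1 :|: S).
have YP v : reflect (v \notin F.1 /\ exists x, (v, x) \notin B) (v \in Y).
  rewrite !inE; case: (v \in F.1) => /=; first by constructor; case.
  by apply: (iffP forallPn) => [?|[]].
pose I := [set v in Y | [forall w in Y, ~~ live v w]].
(* Isolated vertices get private colours in the left summand. The last [inl v] is a default that no
   vertex of [Y] reaches. *)
pose col' v : V + {set V * 'I_k} :=
  if v \in I then inl v else
  if [pick x | (v, x) \notin B] is Some x then inr (col (v, x)) else inl v.
have col'P v : v \in Y -> v \notin I ->
    exists2 x, (v, x) \notin B & col' v = inr (col (v, x)).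
  move=> /YP[_ [x0 x0B]] vI; rewrite /col' (negPf vI).
  by case: pickP => [x xB|/(_ x0)]; [exists x|rewrite x0B].
have inU v x : v \in Y -> (v, x) \notin B -> (v, x) \in blowup_vertices :\: B.
  by move=> /YP[vF _] xB; rewrite !inE /= xB vF.
have nonisolated v w : v \in Y -> w \in Y -> live v w -> v \notin I.
  move=> vY wY vw; rewrite inE vY /=; apply/forall_inPn; exists w => //.
  by rewrite negbK.
exists S, I, (V + {set V * 'I_k})%type, col'; split.
- by rewrite disjoint_subset; apply/subsetP=> v vF; rewrite !inE vF.
- by apply/subsetP=> v; rewrite inE => /andP[].
- move=> v w vY wY vw; have wv : live w v by rewrite live_sym.
  have [x xB ->] := col'P v vY (nonisolated v w vY wY vw).
  have [y yB ->] := col'P w wY (nonisolated w v wY vY wv).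
  by congr inr; apply: ok; rewrite ?inU.
- move=> v w vI wY; rewrite {1}/col' vI /col'; case: ifP => [_ []//|wI].
  by case: pickP => [x _|_ []].
have cardB : k * #|S| <= #|B|.
  rewrite mulnC -[X in _ * X](card_ord k) -cardsT -cardsX.
  apply/subset_leq_card/subsetP => -[v x]; rewrite !inE /= andbT.
  by case/andP=> _ /forallP/(_ x).
have cov : col @: (blowup_vertices :\: B) \subset
    (col @: setX I setT) :|: (col @: [set p in blowup_vertices :\: B | p.1 \notin I]).
  apply/subsetP=> _ /imsetP[[v x] pU ->]; rewrite inE.
  case: (boolP (v \in I)) => vI; apply/orP; [left|right].
    by apply/imsetP; exists (v, x); rewrite // in_setX vI in_setT.
  by apply/imsetP; exists (v, x); rewrite // inE pU vI.
have cU := leq_trans (subset_leq_card cov) (leq_card_setU _ _).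
have cI : #|col @: setX I setT| <= k * #|I|.
  by apply: leq_trans (leq_imset_card _ _) _; rewrite cardsX cardsT card_ord mulnC.
have cN : #|col @: [set p in blowup_vertices :\: B | p.1 \notin I]| <= #|col' @: (Y :\: I)|.
  rewrite -(card_imset _ (@inr_inj V {set V * 'I_k})); apply/subset_leq_card/subsetP.
  move=> _ /imsetP[_ /imsetP[[v x] + ->] ->]; rewrite inE => /andP[xU vI].
  have [xB vF] : (v, x) \notin B /\ v \notin F.1 by move: xU; rewrite !inE => /andP[].
  have vY : v \in Y by apply/YP; split=> //; exists x.
  apply/imsetP; exists v; first by rewrite inE vI.
  have [y yB ->] := col'P v vY vI; congr inr.
  move: (vI); rewrite inE vY /= => /forall_inPn[w wY]; rewrite negbK => vw.
  (* The neighbour [w] has a copy outside [B], adjacent to all copies of [v]; those outside [B]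
     therefore share its colour. *)
  have /YP[_ [z zB]] := wY.
  by transitivity (col (w, z)); last symmetry; apply: ok; rewrite ?inU.
apply: leq_trans (leq_trans le (leq_trans cU (leq_add cI cN))).
by rewrite addnC leq_add.
Qed.

End BlowUp.

(** * Mixed vertex and edge cuts *)

Section MixedCut.
Variables (V : finType) (adj : rel V).

(** Colour classes stand for unions of components of what is left, so parts can be merged without
    speaking of connectivity. *)
Definition separates (C : finType) (col : V -> C) (X : {set V}) (M : {set {set V}}) :=
  forall u v, u \notin X -> v \notin X -> adj u v -> col u != col v ->
  [set u; v] \in M.

Definition colors (C : finType) (col : V -> C) (X : {set V}) := col @: ~: X.

Variables (C : finType) (col : V -> C) (X : {set V}) (M : {set {set V}}).
Hypothesis sep : separates col X M.

Lemma separates_drop E :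
  (forall u v, u \notin X -> v \notin X -> adj u v -> col u != col v -> [set u; v] != E) ->
  separates col X (M :\ E).
Proof. by move=> useless u v uX vX uv cuv; rewrite !inE useless ?sep. Qed.

Lemma separates_vertex (E : {set V}) u : u \in E -> separates col (u |: X) (M :\ E).
Proof.
move=> uE v w; rewrite !inE !negb_or => /andP[vu vX] /andP[wu wX] vw cvw.
rewrite (sep vX wX vw cvw) andbT; apply: contraTneq uE => <-.
by rewrite !inE negb_or eq_sym vu eq_sym wu.
Qed.

Lemma colors_vertex u u' : u' \notin X -> u' != u -> col u' = col u ->
  colors col (u |: X) = colors col X.
Proof.
move=> u'X u'u cu; apply/setP=> a; apply/imsetP/imsetP => -[v].
  by rewrite !inE negb_or => /andP[_ vX] ->; exists v; rewrite ?inE.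
rewrite inE => vX ->; case: (eqVneq v u) => [->|vu].
  by exists u'; rewrite ?cu // !inE negb_or u'u.
by exists v; rewrite // !inE negb_or vu.
Qed.

(** In use, [g w] is a neighbour of [w] in [D]. Each [w] is charged to itself if it lies in [X], and
    otherwise to the edge to [g w]; as [W] and [D] are disjoint, no edge is charged twice. *)
Lemma card_boundary (W D : {set V}) (g : V -> V) :
  [disjoint W & D] -> (forall w, w \in W -> g w \in D) ->
  (forall w, w \in W -> w \notin X -> [set g w; w] \in M) ->
  #|W| <= #|X| + #|M|.
Proof.
move=> WD gD gM; rewrite -(cardsID X W); apply: leq_add.
  by apply/subset_leq_card/subsetIr.
have WDF w w' : w \in W -> w' \in W -> w = g w' -> False.
  by move=> wW /gD gw' eqw; have := disjointFr WD wW; rewrite eqw gw'.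
rewrite -(card_in_imset (f := fun w => [set g w; w])); last first.
  move=> w w'; rewrite !inE => /andP[_ wW] /andP[_ w'W] eqgw.
  have : w \in [set g w'; w'] by rewrite -eqgw set22.
  by case/set2P=> // /(WDF _ _ wW w'W).
apply/subset_leq_card/subsetP => _ /imsetP[w + ->].
by rewrite inE => /andP[wX wW]; apply: gM.
Qed.

End MixedCut.

(** * Counting cells whose row and column colours differ *)

Lemma sum_mul_le (I : finType) (A : {set I}) (x y : I -> nat) :
  \sum_(a in A) x a * y a <= (\sum_(a in A) x a) * (\sum_(a in A) y a).
Proof.
rewrite big_distrl /=; apply: leq_sum => a aA; rewrite leq_mul2l; apply/orP; right.
by rewrite (bigD1 a) //= leq_addr.
Qed.

Section Disagreements.
Variables (n : nat) (C : finType) (rho kappa : 'I_n -> C) (A : {set C}).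
Hypotheses (rhoA : forall i, rho i \in A) (kappaA : forall j, kappa j \in A).

Definition fiber (f : 'I_n -> C) a := #|[set i | f i == a]|.
Definition disagreements : {set 'I_n * 'I_n} :=
  [set p | (p.1 != p.2) && (rho p.1 != kappa p.2)].

Lemma sum_fiber (f : 'I_n -> C) : (forall i, f i \in A) -> \sum_(a in A) fiber f a = n.
Proof.
move=> fA; rewrite -[RHS]card_ord -sum1_card (partition_big f (mem A)) //=.
by apply: eq_bigr => a _; rewrite sum1_card; apply: eq_card => i; rewrite inE.
Qed.

(** All cells of the grid are split into disagreeing ones off the diagonal, disagreeing ones on it,
    and agreeing ones sorted by colour. *)
Lemma card_disagreements :
  #|disagreements| + #|[set i | rho i != kappa i]|
    + \sum_(a in A) fiber rho a * fiber kappa a = n * n.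
Proof.
have -> : n * n = #|{: 'I_n * 'I_n}| by rewrite card_prod card_ord.
rewrite -(cardsC [set p | rho p.1 == kappa p.2]) addnC; congr (_ + _).
  rewrite -sum1_card (partition_big (fun p => rho p.1) (mem A)) //=.
  apply: eq_bigr => a _; rewrite sum1dep_card -cardsX; apply: eq_card => -[i j].
  rewrite !inE /=; case: (eqVneq (rho i) a) => [->|]; last by rewrite andbF.
  by rewrite andbT eq_sym.
rewrite -(cardsID [set p | p.1 != p.2] (~: _)); congr (_ + _).
  by apply: eq_card => p; rewrite !inE andbC.
rewrite -(card_imset _ (can_inj (fun i : 'I_n => erefl : (i, i).1 = i))).
apply: eq_card => -[i j]; rewrite !inE negbK; apply/imsetP/andP => [[l]|[/eqP /= <-]].
  by rewrite inE => + [-> ->].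
by exists i; rewrite ?inE.
Qed.

Hypotheses (rho_onto : forall a, a \in A -> exists i, rho i = a)
  (kappa_onto : forall a, a \in A -> exists j, kappa j = a).

Lemma fiber_gt0 (f : 'I_n -> C) a : (exists i, f i = a) -> 0 < fiber f a.
Proof. by case=> i fi; apply/card_gt0P; exists i; rewrite inE fi. Qed.

(** All fibres are non-empty. Their sizes less 1 add up to n - c for rows and for columns, and a sum
    of products is at most the product of the sums. *)
Lemma sum_fiber_mul_le c : #|A| = c ->
  \sum_(a in A) fiber rho a * fiber kappa a <= c + 2 * (n - c) + (n - c) * (n - c).
Proof.
move=> cA; pose x a := (fiber rho a).-1; pose y a := (fiber kappa a).-1.
have xE a : a \in A -> fiber rho a = x a + 1.
  by move=> /rho_onto/fiber_gt0; rewrite /x; lia.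
have yE a : a \in A -> fiber kappa a = y a + 1.
  by move=> /kappa_onto/fiber_gt0; rewrite /y; lia.
have sx : \sum_(a in A) x a = n - c.
  rewrite -[X in _ = X - c](sum_fiber rhoA) (eq_bigr _ xE) big_split /=.
  by rewrite sum1_card cA addnK.
have sy : \sum_(a in A) y a = n - c.
  rewrite -[X in _ = X - c](sum_fiber kappaA) (eq_bigr _ yE) big_split /=.
  by rewrite sum1_card cA addnK.
rewrite (eq_bigr (fun a => x a * y a + (x a + y a + 1))); last first.
  by move=> a aA; rewrite xE // yE //; lia.
rewrite !big_split /= sum1_card cA sx sy.
by have := sum_mul_le A x y; rewrite sx sy; lia.
Qed.

Lemma card_colors_le : #|A| <= n.
Proof.
rewrite -[leqRHS](sum_fiber rhoA) -sum1_card; apply: leq_sum => a aA.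
exact/fiber_gt0/rho_onto.
Qed.

Lemma disagreements_ge3 : 4 <= n -> 3 <= #|A| -> 2 * n + #|A| <= #|disagreements| + 5.
Proof.
move=> n4 c3; have := card_disagreements; have := sum_fiber_mul_le (erefl #|A|).
have := card_colors_le.
have : #|[set i | rho i != kappa i]| <= n by rewrite -[leqRHS](card_ord n) max_card.
move: #|_| (\sum_(a in A) _) #|disagreements| #|A| c3 => dd s D c c3.
move=> ddn cn sle eqn; have [d nE] : exists d, n = c + d by exists (n - c); lia.
(* The claim becomes c^2 + 2cd + 5 >= 5(c + d); at c = 3 it needs d >= 1, which n >= 4 provides. *)
by rewrite nE addKn in sle eqn ddn n4 *; nia.
Qed.

(** Bounding the diagonal by n is too weak for two colours. A diagonal disagreement involves both
    colours, so the row and column fibres of either colour bound the number of these. *)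
Lemma disagreements_ge2 : 4 <= n -> #|A| = 2 -> 2 * n <= #|disagreements| + 4.
Proof.
move=> n4 /eqP/cards2P[a [b [ab defA]]].
have := card_disagreements; have := sum_fiber rhoA; have := sum_fiber kappaA.
rewrite defA !big_setU1 ?inE //= !big_set1.
have pos c : c \in A -> 0 < fiber rho c /\ 0 < fiber kappa c.
  by move=> cA; rewrite !fiber_gt0 //; [apply: kappa_onto|apply: rho_onto].
have [ra ka] : 0 < fiber rho a /\ 0 < fiber kappa a by apply: pos; rewrite defA set21.
have [rb kb] : 0 < fiber rho b /\ 0 < fiber kappa b by apply: pos; rewrite defA set22.
have dd c d : c != d -> A = [set c; d] ->
    #|[set i | rho i != kappa i]| <= fiber rho c + fiber kappa c.
  move=> cd AE; apply: leq_trans (leq_card_setU _ _).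
  apply/subset_leq_card/subsetP=> i; rewrite !inE.
  have := rhoA i; have := kappaA i; rewrite AE !inE.
  case: eqP => [->|_] /=; [rewrite orbT|move=> /eqP ->]; case: eqP => //= _.
  by move=> /eqP ->; rewrite eqxx.
have dda := dd a b ab defA.
have ddb : #|[set i | rho i != kappa i]| <= fiber rho b + fiber kappa b.
  by apply: (dd b a); rewrite 1?eq_sym // setUC.
move: (fiber rho a) (fiber rho b) (fiber kappa a) (fiber kappa b) ra rb ka kb dda ddb.
move: #|_| #|disagreements| n4 => dg D; clear; move=> n4 r r' k k'.
(* The four fibre sizes add up to 2n, so one of the two colours satisfies this. *)
wlog : r r' k k' / r + k <= n.
  move=> wl; case: (leqP (r + k) n) => [/wl|lt ra rb ka kb dda ddb sk sr eqn]; first exact.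
  apply: (wl r' r k' k) => //; lia.
move=> le ra rb ka kb dda _ sk sr eqn.
have [d dE] : exists d, n = r + k + d by exists (n - (r + k)); lia.
have [r'E k'E] : r' = k + d /\ k' = r + d by lia.
have [s sE] : exists s, r + k = s + 2 by exists (r + k - 2); lia.
have [amgm _] := nat_AGM2 r k; rewrite -mulnn in amgm.
(* This is what remains after bounding r k by AM-GM; at s = 1 it needs d >= 1, that is, n >= 4. *)
have key : 2 * s <= s * s + 2 * (s * d).
  have : 4 <= s + 2 + d by rewrite -sE -dE.
  by case: s {sE} => [|[|s]]; lia.
have expand : (k + d) * (r + d) = r * k + (r + k) * d + d * d by lia.
move: eqn dda; rewrite r'E k'E expand dE; move: (r * k) amgm => p.
by rewrite sE; move: key; clear; lia.
Qed.

End Disagreements.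

(** * The arrangement graph *)

Section ArrangementGraph.
Variable n : nat.
Local Notation V := (arrV n).
Local Notation adj := (@arr_adj n).
Implicit Types (u v w : V) (X : {set V}) (M : {set {set V}}).

Lemma arr_adj_sym : symmetric adj.
Proof. by move=> u v; rewrite /arr_adj (eq_sym (val u).1) (eq_sym (val u).2). Qed.

Lemma arr_adj_irr : irreflexive adj.
Proof. by move=> u; rewrite /arr_adj !eqxx. Qed.

Lemma card_arrV : #|{: V}| = n * n - n.
Proof.
rewrite card_sig -[n in _ - n]card_ord -[X in X * _]card_ord -[X in _ * X - _]card_ord -card_prod.
rewrite -(cardC [pred p : 'I_n * 'I_n | p.1 == p.2]).
rewrite (_ : #|[pred p : 'I_n * 'I_n | p.1 == p.2]| = #|'I_n|) ?addKn.
  by apply: eq_card.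
rewrite -(card_imset predT (can_inj (fun i : 'I_n => erefl : (i, i).1 = i))).
apply: eq_card => -[i j]; rewrite inE; apply/eqP/imsetP => /= [->|[l _ [-> ->]] //].
by exists j.
Qed.

Definition nbrs u : {set V} := [set w | adj u w].

Lemma card_nbrs u : #|nbrs u| = 2 * n - 4.
Proof.
case: u => -[i j] /= ij; set u := exist _ _ _.
rewrite -(card_imset _ val_inj).
have -> : val @: nbrs u =
    setX [set i] (~: [set i; j]) :|: setX (~: [set i; j]) [set j].
  apply/setP=> -[a b]; rewrite !inE /= (eq_sym a i) (eq_sym a j) (eq_sym b i) (eq_sym b j).
  apply/imsetP/idP => [[[[a' b'] /= ab] + [-> ->]]|].
    rewrite inE /arr_adj /= => /orP[/andP[/eqP ia jb]|/andP[ia /eqP jb]].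
      by rewrite -ia eqxx in ab *; rewrite (negPf ab) (negPf jb).
    by rewrite -jb in ab *; rewrite eqxx (negPf ia) (eq_sym j) (negPf ab) orbT.
  move=> h; have ab : a != b.
    case/orP: h => /andP[]; first by move=> /eqP <- /norP[].
    by case/norP => _ ja /eqP <-; rewrite eq_sym.
  exists (exist _ (a, b) ab) => //; rewrite inE /arr_adj /=.
  case/orP: h => /andP[]; first by move=> -> /norP[_ ->].
  by move=> /norP[ia _] ->; rewrite ia orbT.
have disj : [disjoint setX [set i] (~: [set i; j]) & setX (~: [set i; j]) [set j]].
  rewrite disjoint_subset; apply/subsetP=> -[a b]; rewrite !inE /=.
  by case/andP=> /eqP ->; rewrite eqxx.
have [_] := leq_card_setU (setX [set i] (~: [set i; j])) (setX (~: [set i; j]) [set j]).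
rewrite disj => /eqP ->.
rewrite !cardsX !cards1 mul1n muln1.
by have := cardsC [set i; j]; rewrite cards2 ij card_ord; lia.
Qed.

(** Common neighbours lie on the line shared by [u] and [v]: n cells less [u], [v] and the diagonal
    one. *)
Lemma card_common_nbrs u v : adj u v -> #|nbrs u :&: nbrs v| <= n - 3.
Proof.
have c3 (a b c : 'I_n) : a != b -> a != c -> b != c -> #|~: [set a; b; c]| = n - 3.
  move=> ab ac bc; have := cardsC [set a; b; c]; rewrite card_ord setUC cardsU1 cards2.
  by rewrite !inE negb_or eq_sym ac eq_sym bc ab; lia.
case: u v => -[i j] ij [[i' j'] i'j'] uv; rewrite -(card_imset _ val_inj).
have sub (B : {set 'I_n * 'I_n}) :
    (forall p : V, p \in nbrs (exist _ (i, j) ij) -> p \in nbrs (exist _ (i', j') i'j') ->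
      val p \in B) ->
    #|val @: (nbrs (exist _ (i, j) ij) :&: nbrs (exist _ (i', j') i'j'))| <= #|B|.
  move=> inB; apply/subset_leq_card/subsetP => _ /imsetP[p + ->].
  by rewrite inE => /andP[]; apply: inB.
have [nij ni'j'] : i != j /\ i' != j' by [].
move: uv; rewrite /arr_adj /=; case/orP=> /andP[].
  move=> /eqP eqi jj'; subst i'.
  rewrite -(c3 i j j') // -[leqRHS]mul1n -[X in X * _](cards1 i) -cardsX.
  apply: sub => -[[a b] /= ab]; rewrite !inE /arr_adj /= !negb_or (eq_sym a).
  rewrite (eq_sym b i) (eq_sym b j) (eq_sym b j'); case: (eqVneq i a) => [ia|_] /=.
    by rewrite !orbF -ia in ab * => -> ->; rewrite ab.
  by move=> /eqP <-; rewrite eq_sym (negPf jj').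
move=> ii' /eqP eqj; subst j'.
rewrite -(c3 i i' j) // -[leqRHS]muln1 -[X in _ * X](cards1 j) -cardsX.
apply: sub => -[[a b] /= ab]; rewrite !inE /arr_adj /= !negb_or (eq_sym b).
rewrite (eq_sym a i) (eq_sym a i') (eq_sym a j); case: (eqVneq j b) => [jb|_] /=.
  by rewrite !andbF !andbT -jb eq_sym in ab * => /= -> ->; rewrite ab.
by rewrite !andbT !andbF !orbF => /eqP <-; rewrite eq_sym (negPf ii').
Qed.

End ArrangementGraph.

(** * Cuts of the arrangement graph *)

Section ArrangementCut.
Variables (n : nat) (C : finType).
Hypothesis n_ge5 : 5 <= n.
Local Notation V := (arrV n).
Local Notation adj := (@arr_adj n).
Implicit Types (col : V -> C) (X : {set V}) (M : {set {set V}}).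

(** Rows and columns are cliques, so the survivors on each line share a colour. A surviving cell
    agrees with both of its lines, hence [X] contains all disagreements. *)
Lemma vertex_cut col X : separates adj col X set0 -> 2 <= #|colors col X| ->
  2 * n + (if #|colors col X| == 2 then 0 else #|colors col X|.-1) <= #|X| + 4.
Proof.
move=> sep c2; set A := colors col X in c2 *.
have [v0 v0X] : exists v0, v0 \notin X.
  have /card_gt0P[a /imsetP[v]] : 0 < #|A| by apply: leq_trans c2.
  by rewrite inE; exists v.
have same v w : v \notin X -> w \notin X -> adj v w -> col v = col w.
  by move=> vX wX vw; apply/eqP/negPn/negP => /(sep _ _ vX wX vw); rewrite inE.
(* A line without survivors takes the colour of [v0], which keeps all values in [A]. *)
pose side (f : V -> 'I_n) i :=
  if [pick v | (v \notin X) && (f v == i)] is Some v then col v else col v0.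
have sideA f i : side f i \in A.
  rewrite /side; case: pickP => [v /andP[vX _]|_]; apply: imset_f; by rewrite inE.
have side_rows v : v \notin X -> side (fun v => (val v).1) (val v).1 = col v.
  move=> vX; rewrite /side; case: pickP => [w /andP[wX /eqP eqw]|/(_ v)]; last by rewrite vX eqxx.
  case: (eqVneq w v) => [-> //|wv]; apply: same => //.
  rewrite /arr_adj eqw eqxx /= orbF; apply: contra wv => /eqP eqw2; apply/eqP/val_inj.
  exact: injective_projections.
have side_cols v : v \notin X -> side (fun v => (val v).2) (val v).2 = col v.
  move=> vX; rewrite /side; case: pickP => [w /andP[wX /eqP eqw]|/(_ v)]; last by rewrite vX eqxx.
  case: (eqVneq w v) => [-> //|wv]; apply: same => //.
  rewrite /arr_adj eqw eqxx /= andbF andbT; apply: contra wv => /eqP eqw2; apply/eqP/val_inj.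
  exact: injective_projections.
pose rho := side (fun v => (val v).1); pose kappa := side (fun v => (val v).2).
have rhoA i : rho i \in A by apply: sideA.
have kappaA i : kappa i \in A by apply: sideA.
have rho_onto a : a \in A -> exists i, rho i = a.
  by case/imsetP=> v; rewrite inE => vX ->; exists (val v).1; apply: side_rows.
have kappa_onto a : a \in A -> exists i, kappa i = a.
  by case/imsetP=> v; rewrite inE => vX ->; exists (val v).2; apply: side_cols.
have DX : #|disagreements rho kappa| <= #|X|.
  rewrite -(card_imset _ val_inj); apply/subset_leq_card/subsetP => p.
  rewrite inE => /andP[offdiag dis]; apply/imsetP; exists (exist _ p offdiag) => //.
  by apply: contraNT dis => pX; apply/eqP; rewrite [LHS](side_rows _ pX) [RHS](side_cols _ pX).
have n4 : 4 <= n by apply: ltnW.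
case: eqP => cA.
  by have := disagreements_ge2 rhoA kappaA rho_onto kappa_onto n4 cA; lia.
have c3 : 3 <= #|A| by lia.
by have := disagreements_ge3 rhoA kappaA rho_onto kappa_onto n4 c3; lia.
Qed.

Lemma card_nbrs_cut col X M u : separates adj col X M -> u \notin X ->
  (forall w, w \notin X -> col w = col u -> w = u) -> 2 * n - 4 <= #|X| + #|M|.
Proof.
move=> sep uX single; rewrite -(card_nbrs u).
apply: (@card_boundary _ X M (nbrs u) [set u] (fun=> u)).
- by rewrite disjoint_sym disjoints1 inE arr_adj_irr.
- by move=> w _; rewrite set11.
move=> w; rewrite inE => uw wX; apply: sep => //.
by apply/eqP => cuw; move: uw; rewrite (single w) ?arr_adj_irr.
Qed.

(** Without [u] and [v], the two neighbourhoods have at least 2(2n - 4) - (n - 3) - 2 = 3n - 7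
    vertices, each charged to [X] or to an edge of [M] other than uv; that edge adds 1. *)
Lemma card_nbrs2_cut col X M u v : separates adj col X M ->
  u \notin X -> v \notin X -> [set u; v] \in M -> adj u v ->
  (forall w, w \notin X -> col w = col u -> w = u) ->
  (forall w, w \notin X -> col w = col v -> w = v) ->
  3 * n - 6 <= #|X| + #|M|.
Proof.
move=> sep uX vX uvM uv single_u single_v.
pose W := (nbrs u :|: nbrs v) :\: [set u; v].
have cW : 3 * n - 7 <= #|W|.
  have := cardsUI (nbrs u) (nbrs v); rewrite !card_nbrs.
  have := card_common_nbrs uv; rewrite cardsD.
  have : #|(nbrs u :|: nbrs v) :&: [set u; v]| <= 2.
    by apply: leq_trans (subset_leq_card (subsetIr _ _)) _; rewrite cards2; case: eqP.
  by move: #|_| #|_| #|_| n_ge5 => a b c; lia.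
suff : #|W| <= #|X| + #|M :\ [set u; v]|.
  by rewrite [#|M|](cardsD1 [set u; v]) uvM; move: #|_| #|_| #|_| cW n_ge5 => a b c; lia.
apply: (@card_boundary _ X _ W [set u; v] (fun w => if adj u w then u else v)).
- by rewrite disjoint_subset; apply/subsetP=> w; rewrite !inE => /andP[].
- by move=> w _; case: ifP; rewrite ?set21 ?set22.
move=> w; rewrite !inE negb_or => /andP[/andP[wu wv]] nw wX; apply/andP; split.
  apply: contraTneq (set22 (if adj u w then u else v) w) => ->.
  by rewrite !inE negb_or wu.
case: ifP nw => [uw _|_ /= vw]; apply: sep => //; apply/eqP => /esym cw.
  by move: wu; rewrite (single_u w) ?eqxx.
by move: wv; rewrite (single_v w) ?eqxx.
Qed.

Lemma mixed_cut col X M : separates adj col X M -> 2 <= #|colors col X| ->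
  2 * n + (if #|colors col X| == 2 then 0 else #|colors col X|.-1) <= #|X| + #|M| + 4.
Proof.
have [m] := ubnP #|M|; elim: m col X M => // m IH col X M /ltnSE cM sep c2.
have [M0|[E EM]] := set_0Vmem M.
  by rewrite M0 cards0 addn0; apply: vertex_cut => //; rewrite -M0.
have cME : #|M| = #|M :\ E|.+1 by rewrite (cardsD1 E) EM.
have ltM : #|M :\ E| < m by rewrite -cME.
case: (boolP [exists u, exists v, [&& u \notin X, v \notin X, adj u v, col u != col v
    & [set u; v] == E]]); last first.
  move=> /existsPn useless.
  apply: leq_trans (IH col X (M :\ E) ltM _ c2) _; last first.
    by rewrite cME leq_add2r leq_add2l.
  apply: separates_drop => // u v uX vX uv cuv; apply/negP => uvE.
  by have /existsPn/(_ v) := useless u; rewrite uX vX uv cuv uvE.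
move=> /existsP[u /existsP[v /and5P[uX vX uv cuv /eqP uvE]]].
(* As another survivor has the colour of [x], moving [x] into [X] replaces [E] at equal cost and
   loses no colour. *)
have shift x x' : x \in E -> x \notin X -> x' \notin X -> x' != x -> col x' = col x ->
    2 * n + (if #|colors col X| == 2 then 0 else #|colors col X|.-1) <= #|X| + #|M| + 4.
  move=> xE xX x'X x'x cx; rewrite -(colors_vertex x'X x'x cx) in c2 *.
  apply: leq_trans (IH col _ (M :\ E) ltM (separates_vertex sep xE) c2) _.
  by rewrite cardsU1 xX cME add1n addSnnS.
have single x : x \in E -> x \notin X ->
    (forall w, w \notin X -> col w = col x -> w = x) \/
    2 * n + (if #|colors col X| == 2 then 0 else #|colors col X|.-1) <= #|X| + #|M| + 4.
  move=> xE xX.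
  case: (boolP [exists x', [&& x' \notin X, x' != x & col x' == col x]]).
    by move=> /existsP[x' /and3P[x'X x'x /eqP cx]]; right; apply: shift cx.
  move=> /existsPn none; left=> w wX cw; apply/eqP/negPn/negP => wx.
  by have := none w; rewrite wX wx cw eqxx.
have [//|single_u|] := single u _ uX; rewrite -?uvE ?set21 //.
have [//|single_v|] := single v _ vX; rewrite -?uvE ?set22 //.
(* Both endpoints are now singleton parts. For two parts one neighbourhood gives 2n - 4; for three,
   both together give 3n - 6 >= 2n - 2. *)
case: eqP => [_|/eqP c_neq2]; first by have := card_nbrs_cut sep uX single_u; lia.
case: (eqVneq #|colors col X| 3) => [->|c_neq3].
  have uvM : [set u; v] \in M by rewrite uvE.
  by have := card_nbrs2_cut sep uX vX uvM uv single_u single_v; lia.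
(* With four parts or more, merging those of [u] and [v] lowers both the number of parts and [#|M|]
   by one; at least three parts remain, so the same bound formula applies. *)
pose col' w := if col w == col u then col v else col w.
have col'E : colors col' X = colors col X :\ col u.
  apply/setP=> a; rewrite !inE; apply/imsetP/andP => [[w wX ->]|[au /imsetP[w wX aE]]].
    rewrite /col'; case: ifP => [_|/negbT cw]; last by rewrite cw imset_f.
    by rewrite eq_sym cuv imset_f ?inE.
  by exists w; rewrite // /col' -aE (negPf au).
have cc : #|colors col X| = #|colors col' X|.+1.
  by rewrite col'E (cardsD1 (col u)) imset_f ?inE.
have sep' : separates adj col' X (M :\ E).
  move=> x y xX yX xy cxy; rewrite !inE; apply/andP; split.
    apply: contraNneq cxy => xyE.
    have xuv : x \in [set u; v] by rewrite uvE -xyE set21.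
    have yuv : y \in [set u; v] by rewrite uvE -xyE set22.
    have cu' : col' u = col v by rewrite /col' eqxx.
    have cv' : col' v = col v by rewrite /col'; case: ifP.
    by case/set2P: xuv => ->; case/set2P: yuv => ->; rewrite ?cu' ?cv'.
  by apply: sep => //; apply: contraNneq cxy => cxy; rewrite /col' cxy.
have := IH col' X (M :\ E) ltM sep'.
move: c2 c_neq2 c_neq3; rewrite cc cME.
move: #|colors col' X| #|X| #|M :\ E| => c x y c2 c_neq2 c_neq3.
by rewrite ifN; [lia|apply: contra c_neq3 => /eqP ->].
Qed.

End ArrangementCut.

(** * The deletion isolating a vertex, and the minimum *)

Lemma bigmin_eq (I : finType) (P : pred I) (f : I -> nat) x i0 b :
  P i0 -> f i0 <= b -> b <= x -> (forall i, P i -> b <= f i) ->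
  \big[minn/x]_(i | P i) f i = b.
Proof.
move=> Pi0 fi0 bx bf; apply/eqP; rewrite eqn_leq; apply/andP; split; last first.
  by elim/big_ind: _ => // y z by_ bz; rewrite leq_min by_.
have : i0 \in index_enum I by rewrite mem_index_enum.
elim: (index_enum I) => // i s IH; rewrite in_cons big_cons => /predU1P[<-|/IH le].
  by rewrite Pi0 geq_min fi0.
by case: ifP => // _; rewrite geq_min le orbT.
Qed.

Section Isolating.
Variables (V : finType) (adj : rel V) (v : V).
Hypothesis adj_sym : symmetric adj.

Definition edges_at : {set edge adj} := [set E : edge adj | v \in val E].

Lemma card_edges_at : #|edges_at| <= #|[set w | adj v w]|.
Proof.
rewrite -(card_imset _ val_inj); apply: leq_trans (leq_imset_card (fun w => [set v; w]) _).
apply/subset_leq_card/subsetP=> _ /imsetP[E + ->]; rewrite inE => vE.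
have /existsP[a /existsP[b /andP[ab /eqP Eab]]] := valP E; rewrite Eab in vE *.
case/set2P: vE => ->; first by apply/imsetP; exists b; rewrite ?inE.
by apply/imsetP; exists a; rewrite ?inE 1?adj_sym // setUC.
Qed.

(** The isolated [v] has degree 0, while k and k - 1 are positive. *)
Lemma isolating_no_matching k : 2 < k -> ~~ has_pm_or_apm k (set0, edges_at).
Proof.
move=> k_gt2; apply/existsPn => h.
have h0 : int_matching_of (set0, edges_at) h -> hdeg h v = 0.
  case/andP=> /forall_inP dead _; apply: big1 => E vE; apply/eqP/dead.
  by rewrite negb_and negbK inE vE.
apply/norP; split; apply/negP => /andP[/h0 hv].
  by move=> /forallP/(_ v); rewrite inE hv; case: k k_gt2 h h0 hv.
move=> /existsP[v0 /and3P[_ /eqP hv0 /forallP/(_ v)]].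
rewrite inE /= hv; case: eqVneq hv0 => [<-|_ _] /=; last by case: k k_gt2 h h0 hv.
by rewrite hv; case: k k_gt2 h h0 hv => [|[|[]]].
Qed.

End Isolating.

Lemma arr_dsize_ge (k n : nat) (F : delset (@arr_adj n)) :
  0 < k -> 5 <= n -> ~~ has_pm_or_apm k F -> 2 * n - 4 <= dsize F.
Proof.
move=> k_gt0 n5 none; rewrite leqNgt; apply/negP => small.
have [S [I [C [col /=]]]] := barrier (@arr_adj_sym n) (@arr_adj_irr n) k_gt0 none.
set Y := ~: _ => -[disj /subsetP IY ok single bar].
pose X := F.1 :|: S; pose M := [set val E | E in F.2].
have cX : #|X| = #|F.1| + #|S|.
  by have [_] := leq_card_setU F.1 S; rewrite disj => /eqP.
have cM : #|M| <= #|F.2| by apply: leq_imset_card.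
have sep : separates (@arr_adj n) col X M.
  move=> u v uX vX uv; apply: contraNT => uvM; apply/eqP; apply: ok; rewrite ?in_setC //.
  by rewrite /live uv.
have cIY : #|I| + #|Y :\: I| = #|Y|.
  by rewrite -(cardsID I Y) (setIidPr _) //; apply/subsetP.
have cI : #|col @: I| = #|I|.
  by apply: card_in_imset => x y xI yI; apply: single; rewrite ?IY.
(* Vertices of [I] have private colours, so the number of parts is i + q. *)
have ccol : #|colors col X| = #|I| + #|col @: (Y :\: I)|.
  have -> : colors col X = col @: I :|: col @: (Y :\: I).
    rewrite -imsetU; suff -> : I :|: (Y :\: I) = Y by [].
    by apply/setP=> y; rewrite in_setU in_setD; case: (boolP (y \in I)) => // /IY ->.
  have [_] := leq_card_setU (col @: I) (col @: (Y :\: I)).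
  suff -> : [disjoint col @: I & col @: (Y :\: I)] by rewrite cI => /eqP.
  rewrite disjoint_subset; apply/subsetP=> _ /imsetP[x xI ->]; rewrite inE.
  apply/imsetP => -[y]; rewrite inE => /andP[yI yY] /(single _ _ xI yY) xy.
  by rewrite -xy xI in yI.
have cq : (#|col @: (Y :\: I)| == 0) = (#|Y :\: I| == 0).
  by rewrite !cards_eq0 imset_eq0.
have cY : #|X| + #|Y| = n * n - n by rewrite -card_arrV -(cardsC X).
have n2 : 5 * n <= n * n by rewrite leq_mul2r n5 orbT.
have cut := mixed_cut n5 sep; rewrite ccol in cut.
move: small bar cX cM cIY cY cut; rewrite /dsize.
move: #|F.1| #|F.2| #|X| #|M| #|S| #|I| #|Y| #|Y :\: I| #|col @: _| cq n2 n5 k_gt0.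
clear; move=> f m x mm s i y yi q cq n2 n5 k_gt0 small bar cX cM cIY cY cut.
(* For three parts or more, the cut bound and |F| <= 2n - 5 give s >= i + q, against k s + 2 <= k i
   + q. *)
case: (leqP 3 (i + q)) => [c3|].
  have le_s : i + q <= s by move: cut; rewrite ifN; lia.
  have : k * (i + q) <= k * s by rewrite leq_mul2l le_s orbT.
  have : q <= k * q by rewrite leq_pmull.
  lia.
rewrite ltnS => c_le2.
have q_le : q <= k * q by rewrite leq_pmull.
have kc_le : k * (i + q) <= k * 2 by rewrite leq_mul2l c_le2 orbT.
have yi0 : q = 0 -> yi = 0 by move=> q0; apply/eqP; rewrite -cq q0.
(* For at most two parts, k s + 2 <= 2k leaves s = 0 and s = 1. *)
case: s bar cX cut => [|[|s]] bar cX cut; last by nia.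
  (* For s = 0, two parts violate the cut bound, and a single part would be one isolated vertex; but
     [X] is too small to leave only one of the n^2 - n vertices. *)
  case: (leqP 2 (i + q)) => [c2|c1]; first by move: cut; case: ifP => _; lia.
  case: i bar cIY c1 {cut cq c_le2 kc_le} => [|i] bar cIY c1; first by lia.
  have q0 : q = 0 by lia.
  by move: (yi0 q0) => yi_0; lia.
(* For s = 1, the barrier forces [Y] to be two isolated vertices, again too few. *)
case: i bar cIY c_le2 {cut cq kc_le} => [|[|i]] bar cIY c_le2; [lia|lia|].
have q0 : q = 0 by lia.
by move: (yi0 q0) => yi_0; lia.
Qed.

Theorem theorem3p15 (k n : nat) :
  3 <= k -> odd k -> 5 <= n -> smp (@arr_adj n) k = 2 * n - 4.
Proof.
move=> k3 _ n5; have k_gt0 : 0 < k by apply: leq_trans k3.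
have [v _] : exists v : arrV n, true.
  have /card_gt0P[v _] : 0 < #|{: arrV n}| by rewrite card_arrV; nia.
  by exists v.
(* The extremal deletion removes the 2n - 4 edges at one vertex. *)
apply: (@bigmin_eq _ _ _ _ (set0, edges_at (@arr_adj n) v)).
- exact: isolating_no_matching.
- rewrite /dsize cards0 add0n -(card_nbrs v); exact: card_edges_at (@arr_adj_sym n).
(* The default of the minimum exceeds the number of vertices, hence 2n - 4. *)
- by rewrite card_arrV; nia.
by move=> F; apply: arr_dsize_ge.
Qed.
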